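(* For every positive integer $c$ and every integer $n>2$, there exists an Anosov rational Lie algebra of nilpotency class $c$ and of type $(n,n,\ldots,n)$ ($c$ entries).
   Context: The lower central series is $\gamma_1(\mathfrak{n})=\mathfrak{n}$, $\gamma_i(\mathfrak{n})=[\mathfrak{n},\gamma_{i-1}(\mathfrak{n})]$; $\mathfrak{n}$ has nilpotency class $c$ if $\gamma_{c+1}(\mathfrak{n})=0\neq\gamma_c(\mathfrak{n})$. The type of a nilpotent Lie algebra of class $c$ is the $c$-tuple $(n_1,\ldots,n_c)$ with $n_i=\dim\gamma_i(\mathfrak{n})/\gamma_{i+1}(\mathfrak{n})$. A rational Lie algebra is Anosov if it admits an automorphism that is hyperbolic (no eigenvalue of absolute value $1$) and integer-like (characteristic polynomial with integer coefficients and determinant $\pm1$). *)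

(* Defs.v *)
From HB Require Import structures.
From mathcomp Require Import all_boot all_order all_algebra all_field.
Set Implicit Arguments. Unset Strict Implicit. Unset Printing Implicit Defensive.
Import Order.TTheory GRing.Theory Num.Theory.
Local Open Scope ring_scope.

Definition is_lie_algebra (d : nat) (br : 'rV[rat]_d -> 'rV[rat]_d -> 'rV[rat]_d) : Prop :=
  [/\ (forall (a : rat) x y z, br (a *: x + y) z = a *: br x z + br y z),
      (forall (a : rat) x y z, br z (a *: x + y) = a *: br z x + br z y),
      (forall x, br x x = 0) &
      (forall x y z, br x (br y z) + br y (br z x) + br z (br x y) = 0)].

(* lcs_aux br k is (a matrix whose row space is) gamma_{k+1}:
   gamma_1 = n, gamma_{k+2} = [n, gamma_{k+1}] = span of the brackets
   [e_j, g] with e_j the standard basis and g running over the rows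
   spanning gamma_{k+1} (this span is [n, gamma_{k+1}] by bilinearity). *)
Fixpoint lcs_aux (d : nat) (br : 'rV[rat]_d -> 'rV[rat]_d -> 'rV[rat]_d) (k : nat)
  : 'M[rat]_d :=
  match k with
  | 0 => 1%:M
  | k'.+1 => (\sum_(j < d) \sum_(l < d)
                 <<br (delta_mx 0 j) (row l (lcs_aux br k'))>>)%MS
  end.

(* gamma_i for i >= 1 (gamma 0 is set equal to gamma 1; never used). *)
Definition lcs (d : nat) (br : 'rV[rat]_d -> 'rV[rat]_d -> 'rV[rat]_d) (i : nat)
  : 'M[rat]_d := lcs_aux br i.-1.

Definition has_nil_class (d : nat) (br : 'rV[rat]_d -> 'rV[rat]_d -> 'rV[rat]_d)
  (c : nat) : Prop :=
  \rank (lcs br c.+1) = 0%N /\ \rank (lcs br c) <> 0%N.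

Definition has_constant_type (d : nat) (br : 'rV[rat]_d -> 'rV[rat]_d -> 'rV[rat]_d)
  (c n : nat) : Prop :=
  forall i : nat, (1 <= i <= c)%N ->
    \rank (lcs br i) = (n + \rank (lcs br i.+1))%N.

Definition is_lie_automorphism (d : nat)
  (br : 'rV[rat]_d -> 'rV[rat]_d -> 'rV[rat]_d) (A : 'M[rat]_d) : Prop :=
  A \in unitmx /\ (forall x y, br x y *m A = br (x *m A) (y *m A)).

Definition hyperbolic (d : nat) (A : 'M[rat]_d) : Prop :=
  forall z : algC, root (map_poly ratr (char_poly A)) z -> `|z| != 1.

Definition integer_like (d : nat) (A : 'M[rat]_d) : Prop :=
  char_poly A \is a polyOver Num.int /\ (\det A = 1 \/ \det A = -1).

Definition anosov (d : nat) (br : 'rV[rat]_d -> 'rV[rat]_d -> 'rV[rat]_d) : Prop :=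
  exists A : 'M[rat]_d,
    [/\ is_lie_automorphism br A, hyperbolic A & integer_like A].

(* Main.v *)
(** Let E be a commutative Q-algebra of dimension n with an endomorphism s.  On
    the sum of c copies of E, the bracket whose components are
      [x,y]_1 = 0,  [x,y]_2 = x_1 s(y_1) - y_1 s(x_1),
      [x,y]_(m+1) = x_1 y_m - y_1 x_m  for m >= 2
    satisfies the Jacobi identity.  If the elements x s(y) - y s(x) span E, the
    lower central series strips off one copy of E at a time, so that the type is
    (n, ..., n).  A unit l of an order of E acts as an automorphism: by l on the
    first copy, by l^m s(l) on copy number m + 1.

    For N = 7, 15, 11 take E = Q[x]/(f) with f the minimal polynomial of
    zeta + 1/zeta, zeta a primitive N-th root of unity: it has degree 3, 4, 5,
    s maps x to x^2 - 2 (that is, zeta to zeta^2), and l = x.  The roots r of f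
    are real, so |r^j s(r)| = 1 means r^(2j) s(r)^2 = 1; transporting this by the
    automorphism zeta -> zeta^2 of the algebraic numbers gives s^2(r)^2 = r^(2j^2),
    and iterating around the finite orbit forces r^2 = 1, except possibly for
    j = 1, which is excluded by hand.  Every n > 2 is a sum of 3s, 4s and 5s, and
    the data on E are stable under products. *)
Require Import Defs.
From HB Require Import structures.
From mathcomp Require Import all_boot all_order all_algebra all_field.
From mathcomp Require Import ring.
Set Implicit Arguments. Unset Strict Implicit. Unset Printing Implicit Defensive.
Import Order.TTheory GRing.Theory Num.Theory.
Local Open Scope ring_scope.

(** * From twisted algebras to Anosov Lie algebras *)

(** Phrased with eigenvectors instead of the characteristic polynomial, so that it can be checked
    one layer or one direct factor at a time. *)
Definition no_unit_eigenvalue n (M : 'M[int]_n) :=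
  forall (z : algC) (v : 'rV[algC]_n),
    v != 0 -> v *m map_mx intr M = z *: v -> `|z| != 1.

(* [tsig] is the endomorphism s acting on row vectors; [tA] and [tB] are the
   multiplications by the unit l and by s(l) in an integral basis. *)
Record twisted_algebra (n : nat) := TwistedAlgebra {
  tmul : 'rV[rat]_n -> 'rV[rat]_n -> 'rV[rat]_n;
  tsig : 'M[rat]_n;
  tone : 'rV[rat]_n;
  tA : 'M[int]_n;
  tB : 'M[int]_n;
  tmulC : commutative tmul;
  tmulP : forall x, linear (tmul x);
  tmulCA : left_commutative tmul;
  tmul1 : left_id tone tmul;
  tspan : forall u, exists s : seq ('rV[rat]_n * 'rV[rat]_n),
    u = \sum_(p <- s) (tmul p.1 (p.2 *m tsig) - tmul p.2 (p.1 *m tsig));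
  tA_unit : tA \in unitmx;
  tB_unit : tB \in unitmx;
  tmulA : forall x y, tmul (x *m map_mx intr tA) y = tmul x y *m map_mx intr tA;
  tmulB : forall x y, tmul (x *m map_mx intr tB) y = tmul x y *m map_mx intr tB;
  tAsig : map_mx intr tA *m tsig = tsig *m map_mx intr tB;
  tA_hyp : no_unit_eigenvalue tA;
  tAB_hyp : forall k, no_unit_eigenvalue (tA ^+ k *m tB)
}.

(** * Block-diagonal operators, encoded by their action on the rows of a matrix *)

Section RowwiseAction.
Variables (R : comPzRingType) (c n : nat).
Implicit Types (L : 'I_c -> 'M[R]_n) (X : 'M[R]_(c, n)).

Definition rowwise L X := \matrix_(i < c) (row i X *m L i).

Lemma rowwise_linear L : linear (rowwise L).
Proof. by move=> a X Y; apply/row_matrixP=> i;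
   rewrite [RHS]linearP /= !rowK linearP mulmxDl -scalemxAl. Qed.

HB.instance Definition _ L :=
  GRing.isLinear.Build R 'M[R]_(c, n) 'M[R]_(c, n) *:%R (rowwise L) (rowwise_linear L).
End RowwiseAction.

Lemma map_lin_rowwise (R S : comPzRingType) (f : {rmorphism R -> S}) c n
    (L : 'I_c -> 'M[R]_n) :
  map_mx f (lin_mx (rowwise L)) = lin_mx (rowwise (fun i => map_mx f (L i))).
Proof.
apply: map_lin_mx => X; apply/row_matrixP=> i.
by rewrite -map_row !rowK map_mxM map_row.
Qed.

Lemma lin_rowwise_unit c n (L : 'I_c -> 'M[int]_n) :
  (forall i, L i \in unitmx) -> lin_mx (rowwise L) \in unitmx.
Proof.
move=> Lu; apply: (proj1 (mulmx1_unit (B := lin_mx (rowwise (fun i => invmx (L i))))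
    _)).
apply/row_matrixP=> i; rewrite !rowE mulmxA !mul_rV_lin mulmx1 mxvecK /=.
rewrite -[RHS]vec_mxK; congr mxvec; apply/row_matrixP=> j.
by rewrite !rowK mulmxK.
Qed.

(** The only units of [int] are 1 and -1, so invertibility over [int] gives the determinant
    condition. *)
Lemma int_unitmx_integer_like d (B : 'M[int]_d) :
  B \in unitmx -> integer_like (map_mx intr B).
Proof.
move=> Bu; split.
  rewrite -map_char_poly; apply/polyOverP=> i.
  by rewrite coef_map /= intr_int.
by rewrite det_map_mx; move: Bu; rewrite unitmxE => /orP[] /eqP ->; [left|right].
Qed.

(** * The bracket attached to a twisted algebra *)

Section LieAlgebra.
Variables (n c : nat) (E : twisted_algebra n).
Local Notation mul := (tmul E).
Local Notation S := (tsig E).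
Local Notation ratm := (map_mx (intr : int -> rat)).
Local Notation V := 'M[rat]_(c.+1, n).

Lemma tmulr0 x : mul x 0 = 0.
Proof. by have := tmulP E x (-1) 0 0; rewrite scaler0 addr0 scaleN1r addNr. Qed.

Lemma tmul0r x : mul 0 x = 0. Proof. by rewrite tmulC tmulr0. Qed.

Lemma tmulPl a x y z : mul (a *: x + y) z = a *: mul x z + mul y z.
Proof. by rewrite tmulC tmulP !(tmulC E z). Qed.

Lemma tmulBr x y z : mul x (y - z) = mul x y - mul x z.
Proof. by rewrite addrC -scaleN1r tmulP scaleN1r addrC. Qed.

(** Natural-number indices let the bracket be defined by cases on the index; because of [inord] they
    are meaningful only for [i <= c], whence the bound in the lemmas below. *)
Definition layer (X : V) i : 'rV[rat]_n := row (inord i) X.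

Lemma layerP (X Y : V) : (forall i, (i <= c)%N -> layer X i = layer Y i) -> X = Y.
Proof.
move=> eqXY; apply/row_matrixP=> i.
by have := eqXY i; rewrite /layer inord_val => -> //; rewrite -ltnS.
Qed.

Lemma layer_linear a X Y i : layer (a *: X + Y) i = a *: layer X i + layer Y i.
Proof. exact: linearP. Qed.

(** Layers are numbered from 0: layer [i] is copy [i + 1] of E. There are [c.+1] of them, so the
    nilpotency class will be [c.+1]. *)
Definition twisted_br_row (X Y : V) (i : nat) : 'rV[rat]_n :=
  match i with
  | 0 => 0
  | 1 => mul (layer X 0) (layer Y 0 *m S) - mul (layer Y 0) (layer X 0 *m S)
  | j.+1 => mul (layer X 0) (layer Y j) - mul (layer Y 0) (layer X j)
  end.

Definition mxbr (X Y : V) : V := \matrix_(i < c.+1) twisted_br_row X Y i.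

Lemma layer_mxbr X Y i : (i <= c)%N -> layer (mxbr X Y) i = twisted_br_row X Y i.
Proof. by move=> ic; rewrite /layer rowK inordK. Qed.

Definition of_layer i (v : 'rV[rat]_n) : V := \matrix_(j < c.+1) (if j == i :> nat then
    v else 0).

Lemma layer_of_layer i v j : (j <= c)%N -> layer (of_layer i v) j = if j == i then v
    else 0.
Proof. by move=> jc; rewrite /layer rowK inordK. Qed.

Lemma sum_of_layer X : X = \sum_(i < c.+1) of_layer i (layer X i).
Proof.
apply: layerP => j jc; rewrite {2}/layer linear_sum /= (bigD1 (inord j)) //=.
rewrite big1 ?addr0 => [|i ij]; rewrite -/(layer _ j) layer_of_layer //.
  by rewrite inordK ?eqxx.
case: eqP => // jEi; case/eqP: ij; apply: val_inj; by rewrite /= inordK.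
Qed.

Lemma of_layerD i (v w : 'rV[rat]_n) : of_layer i (v + w) = of_layer i v + of_layer i w.
Proof.
by apply/row_matrixP=> j; rewrite linearD /= !rowK; case: eqP; rewrite ?addr0.
Qed.

Lemma of_layer0 i : of_layer i 0 = 0.
Proof. by apply/row_matrixP=> j; rewrite rowK row0 if_same. Qed.

Definition twisted_br (x y : 'rV[rat]_(c.+1 * n)) : 'rV[rat]_(c.+1 * n) :=
  mxvec (mxbr (vec_mx x) (vec_mx y)).

Lemma mxbr_linear a X Y Z : mxbr (a *: X + Y) Z = a *: mxbr X Z + mxbr Y Z.
Proof.
apply: layerP => i ic; rewrite layer_linear !layer_mxbr //.
case: i ic => [|[|i]] ic /=; first by rewrite scaler0 addr0.
  rewrite !layer_linear mulmxDl -scalemxAl tmulPl tmulP scalerBr.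
  by rewrite opprD addrACA.
by rewrite !layer_linear tmulPl tmulP scalerBr opprD addrACA.
Qed.

Lemma mxbr_anti X Y : mxbr X Y = - mxbr Y X.
Proof.
apply: layerP => i ic; rewrite [RHS]linearN /= -/(layer _ _) !layer_mxbr //.
by case: i ic => [|[|i]] ic /=; rewrite ?oppr0 ?opprB.
Qed.

(** A bracket has zero layer 0, so layer [i] of a double bracket is x_0 (y_0 w_Z - z_0 w_Y), where w
    is s of layer 0 for [i = 2] and layer [i - 2] for larger [i]. The cyclic sum of these cancels in
    E; layers 0 and 1 vanish. *)
Lemma mxbr_jacobi X Y Z :
  mxbr X (mxbr Y Z) + mxbr Y (mxbr Z X) + mxbr Z (mxbr X Y) = 0.
Proof.
apply: layerP => i ic; rewrite {1}/layer !linearD /= -!/(layer _ _) !layer_mxbr //.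
rewrite [RHS]/layer row0.
case: i ic => [|[|[|i]]] ic /=; rewrite ?addr0 //.
- by rewrite !layer_mxbr //= mul0mx !tmulr0 !tmul0r !subrr !addr0.
- rewrite !layer_mxbr ?(ltnW ic) //= !tmul0r !subr0 !tmulBr.
  set x := layer X 0; set y := layer Y 0; set z := layer Z 0.
  rewrite (tmulCA E y x) (tmulCA E z y) (tmulCA E z x).
  set p := mul x _; set q := mul x _; set r := mul y _.
  by rewrite [p - q + _]addrC !subrKA subrr.
rewrite !layer_mxbr ?(ltnW ic) //= !tmul0r !subr0 !tmulBr.
set x := layer X 0; set y := layer Y 0; set z := layer Z 0.
rewrite (tmulCA E y x) (tmulCA E z y) (tmulCA E z x).
set p := mul x _; set q := mul x _; set r := mul y _.
by rewrite [p - q + _]addrC !subrKA subrr.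
Qed.

Lemma br_is_lie : is_lie_algebra twisted_br.
Proof.
split=> [a x y z|a x y z|x|x y z]; rewrite /twisted_br.
- by rewrite linearP mxbr_linear linearP.
- rewrite linearP mxbr_anti mxbr_linear [mxbr _ (vec_mx z)]mxbr_anti.
  by rewrite [mxbr (vec_mx y) _]mxbr_anti scalerN -opprD opprK linearP.
- rewrite -[RHS](linear0 mxvec); congr mxvec.
  apply: layerP => i ic; rewrite layer_mxbr // [RHS]/layer row0.
  by case: i ic => [|[|i]] ic //=; rewrite subrr.
by rewrite !mxvecK -!linearD /= mxbr_jacobi linear0.
Qed.

(** * The lower central series *)

Definition low_zero k : 'M[rat]_(c.+1 * n) :=
  kermx (lin_mx (mulmx (pid_mx k : 'M[rat]_c.+1))).

(** Left multiplication by [pid_mx k] keeps the first [k] rows and kills the others. *)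
Lemma low_zeroP k X :
  reflect (forall i, (i <= c)%N -> (i < k)%N -> layer X i = 0)
          (mxvec X <= low_zero k)%MS.
Proof.
have rowp i : row i (pid_mx k *m X) = if (i < k)%N then row i X else 0.
  apply/rowP=> j; rewrite !mxE (bigD1 i) //= mxE eqxx big1 ?addr0 => [|l li].
    by case: ifP => _; rewrite ?mul1r ?mul0r mxE.
  by rewrite mxE eq_sym -val_eqE /= in li *; rewrite (negbTE li) mul0r.
apply: (iffP idP) => [/sub_kermxP | X0].
  rewrite mul_vec_lin => /(canRL (@mxvecK _ _ _)); rewrite linear0 => X0 i ic ik.
  by have := rowp (inord i); rewrite inordK // ik X0 row0.
apply/sub_kermxP; rewrite mul_vec_lin -[RHS](linear0 mxvec); congr mxvec.
apply/row_matrixP=> i; rewrite rowp row0; case: ifP => // ik.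
by have := X0 i; rewrite /layer inord_val => -> //; rewrite -ltnS.
Qed.

Lemma br_delta_sum (x y : 'rV[rat]_(c.+1 * n)) :
  twisted_br x y = \sum_j x 0 j *: twisted_br (delta_mx 0 j) y.
Proof.
have [brl _ _ _] := br_is_lie.
pose f z := twisted_br z y; have fl : linear f by move=> a u v; rewrite /f brl.
pose fL := GRing.isLinear.Build _ _ _ _ f fl.
pose F : {linear 'rV[rat]_(c.+1 * n) -> 'rV[rat]_(c.+1 * n)} := HB.pack f fL.
rewrite -/(f x) {1}(row_sum_delta x) -[f]/(F : _ -> _) linear_sum.
by apply: eq_bigr => j _; rewrite linearZ.
Qed.

(** [lcs_aux] brackets only standard basis vectors with the rows of the previous matrix; bilinearity
    extends this to arbitrary elements. *)
Lemma br_lcs k x y : (y <= lcs_aux twisted_br k)%MS -> (twisted_br x y <= lcs_aux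
    twisted_br k.+1)%MS.
Proof.
have [_ brr _ _] := br_is_lie.
case/submxP=> w ->; rewrite br_delta_sum; apply: summx_sub => j _.
apply: scalemx_sub; pose f z := twisted_br (delta_mx 0 j) z.
have fl : linear f by move=> a u v; rewrite /f brr.
pose fL := GRing.isLinear.Build _ _ _ _ f fl.
pose F : {linear 'rV[rat]_(c.+1 * n) -> 'rV[rat]_(c.+1 * n)} := HB.pack f fL.
rewrite -/(f _) mulmx_sum_row -[f]/(F : _ -> _) linear_sum.
apply: summx_sub => l _; rewrite linearZ; apply: scalemx_sub.
apply: (sumsmx_sup j) => //; apply: (sumsmx_sup l) => //.
by rewrite genmxE.
Qed.

Lemma mxbr_lcs k X Y :
  (mxvec Y <= lcs_aux twisted_br k)%MS -> (mxvec (mxbr X Y) <= lcs_aux twisted_br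
      k.+1)%MS.
Proof. by move/(br_lcs (mxvec X)); rewrite /twisted_br !mxvecK. Qed.

(** Bracketing with an element whose first [k] layers vanish gives one whose first [k.+1] layers
    vanish. Conversely, each remaining layer is reached separately by brackets. *)
Lemma lcs_low_zero k : (k <= c.+1)%N -> (lcs_aux twisted_br k :=: low_zero k)%MS.
Proof.
elim: k => [|k IH] kc.
  apply/eqmxP; rewrite submx1 andbT; apply/row_subP=> i.
  by rewrite -[row i _]vec_mxK; apply/low_zeroP.
apply/eqmxP/andP; split.
  apply/sumsmx_subP=> j _; apply/sumsmx_subP=> l _; rewrite genmxE.
  apply/low_zeroP=> i ic ik; rewrite layer_mxbr //.
  have y0 : forall i, (i <= c)%N -> (i < k)%N ->
      layer (vec_mx (row l (lcs_aux twisted_br k))) i = 0.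
    by apply/low_zeroP; rewrite vec_mxK -IH ?row_sub // ltnW.
  case: i ic ik => [|[|i]] ic ik //=.
    by rewrite y0 // mul0mx tmulr0 tmul0r subrr.
  have ik' : (i.+1 < k)%N by [].
  by rewrite !y0 ?tmulr0 ?tmul0r ?subrr // ?(ltnW ic) // (leq_ltn_trans _ ik').
apply/row_subP=> r; set u := row r _; have : (u <= low_zero k.+1)%MS by rewrite row_sub.
rewrite -[u]vec_mxK; move: (vec_mx u) => {u r} X /low_zeroP X0.
rewrite [X]sum_of_layer linear_sum; apply: summx_sub => i _.
have [ik|ki] := ltnP i k.+1.
  by rewrite X0 ?of_layer0 ?linear0 ?sub0mx // -ltnS.
case: i ki => [[|[|i]] ilt] // ki; rewrite [nat_of_ord _]/=.
  case: k ki IH {kc X0} => // _ _.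
  (* Here [k = 0]: layer 1 consists of sums of terms x s(y) - y s(x), which are brackets of elements
     concentrated in layer 0. *)
  have [s ->] := tspan E (layer X 1).
  elim: s => [|p s IHs]; first by rewrite big_nil of_layer0 linear0 sub0mx.
  rewrite big_cons of_layerD linearD addmx_sub //.
  suff -> : of_layer 1 (mul p.1 (p.2 *m S) - mul p.2 (p.1 *m S))
          = mxbr (of_layer 0 p.1) (of_layer 0 p.2).
    by apply: mxbr_lcs; rewrite submx1.
  apply: layerP => j jc; rewrite layer_mxbr // layer_of_layer //.
  case: j jc => [|[|j]] jc //=; rewrite !layer_of_layer ?(ltnW jc) //=.
  by rewrite !tmulr0 subrr.
(* From layer 2 on one bracket is enough: the unit of E, put in layer 0, shifts layer [i.+1] to
   layer [i.+2]. *)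
suff -> : of_layer i.+2 (layer X i.+2) = mxbr (of_layer 0 (tone E)) (of_layer i.+1
    (layer X i.+2)).
  apply: mxbr_lcs; rewrite IH 1?ltnW //; apply/low_zeroP=> j jc jk.
  by rewrite layer_of_layer //; case: eqP => // ji; move: ki; rewrite ltnS -ji leqNgt
      jk.
apply: layerP => j jc; rewrite layer_mxbr // layer_of_layer //.
case: j jc => [|[|j]] jc //=; rewrite !layer_of_layer ?(ltnW jc) //=.
  by rewrite mul0mx tmulr0 tmul0r subrr.
by rewrite tmul1 tmul0r subr0 eqSS.
Qed.

(** Rank-nullity for the projection to layer [k]: on elements supported in layers [k] and above it
    is onto, and its kernel is the next term of the series. *)
Lemma rank_lcs k : (k <= c)%N ->
  \rank (lcs_aux twisted_br k) = (n + \rank (lcs_aux twisted_br k.+1))%N.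
Proof.
move=> kc; pose B := lin_mx (fun X : V => row (inord k) X).
have linB X : mxvec X *m B = mxvec (layer X k) by rewrite mul_vec_lin.
rewrite -(mxrank_mul_ker _ B); congr (_ + _)%N.
  rewrite -[RHS]mul1n; apply/eqP; rewrite -[_ == _]/(row_full _) -sub1mx.
  apply/row_subP=> i; rewrite -[row i _]vec_mxK; set v := vec_mx _.
  have -> : mxvec v = mxvec (of_layer k v) *m B by rewrite linB layer_of_layer // eqxx.
  apply: submxMr; rewrite lcs_low_zero ?leqW //; apply/low_zeroP=> j jc jk.
  by rewrite layer_of_layer //; case: eqP jk => // ->; rewrite ltnn.
apply: eqmx_rank; apply/andP; split; apply/row_subP=> i.
  set u := row i _; have : (u <= lcs_aux twisted_br k :&: kermx B)%MS by rewrite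
      row_sub.
  rewrite sub_capmx -[u]vec_mxK lcs_low_zero ?leqW // => /andP[/low_zeroP u0].
  move/sub_kermxP; rewrite linB => /(canRL (@mxvecK _ _ _)); rewrite linear0 => uk.
  rewrite lcs_low_zero //; apply/low_zeroP=> j jc.
  by rewrite ltnS leq_eqVlt => /orP[/eqP ->|] //; apply: u0.
set u := row i _; have : (u <= lcs_aux twisted_br k.+1)%MS by rewrite row_sub.
rewrite lcs_low_zero // -[u]vec_mxK => /low_zeroP u0.
rewrite sub_capmx lcs_low_zero ?leqW //; apply/andP; split.
  by apply/low_zeroP=> j jc jk; apply: u0 => //; apply: ltnW.
by apply/sub_kermxP; rewrite linB u0 // linear0.
Qed.

Lemma br_constant_type : has_constant_type twisted_br c.+1 n.
Proof. by case=> // i /= ic; apply: rank_lcs. Qed.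

Lemma br_nil_class : (0 < n)%N -> has_nil_class twisted_br c.+1.
Proof.
move=> n0; split; last first.
  by rewrite /lcs rank_lcs // => /eqP; rewrite addn_eq0 eqn0Ngt n0.
apply/eqP; rewrite mxrank_eq0 -submx0 /lcs [c.+2.-1]/= lcs_low_zero //.
apply/row_subP=> i; set u := row i _; have : (u <= low_zero c.+1)%MS by rewrite row_sub.
rewrite -[u]vec_mxK => /low_zeroP u0; rewrite submx0; apply/eqP.
rewrite -[RHS](linear0 mxvec); congr mxvec; apply: layerP => j jc.
by rewrite u0 // /layer row0.
Qed.

(** * The automorphism and its eigenvalues *)

Definition layer_unit (i : nat) : 'M[int]_n :=
  if i is 0 then tA E else tA E ^+ i *m tB E.

Definition layer_autZ : 'M[int]_(c.+1 * n) := lin_mx (rowwise (fun i : 'I_c.+1 =>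
    layer_unit i)).

Lemma layer_unit_unitmx i : layer_unit i \in unitmx.
Proof.
case: i => [|i]; first exact: tA_unit.
rewrite /layer_unit unitmx_mul tB_unit andbT.
elim: i.+1 => [|j IH]; first by rewrite expr0 unitmx1.
by rewrite exprS unitmx_mul tA_unit.
Qed.

Lemma layer_unit_hyp i : no_unit_eigenvalue (layer_unit i).
Proof. by case: i => [|i]; [apply: tA_hyp | apply: tAB_hyp]. Qed.

Lemma tmul_layer_unit i x y :
  mul (x *m ratm (tA E ^+ i *m tB E)) y = mul x y *m ratm (tA E ^+ i *m tB E).
Proof.
rewrite !map_mxM !mulmxA tmulB; congr (_ *m _).
elim: i x => [|i IH] x; first by rewrite expr0 map_mx1 !mulmx1.
by rewrite exprS map_mxM !mulmxA IH tmulA.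
Qed.

Lemma tmul_layer_unit_r i x y :
  mul x (y *m ratm (tA E ^+ i *m tB E)) = mul x y *m ratm (tA E ^+ i *m tB E).
Proof. by rewrite tmulC tmul_layer_unit tmulC. Qed.

(** In layer 1 the factor is l s(l), because s(l x) = s(l) s(x) by [tAsig]; each further bracket
    with layer 0 contributes one more factor l. *)
Lemma layer_autZ_aut : is_lie_automorphism twisted_br (ratm layer_autZ).
Proof.
split.
  rewrite unitmxE det_map_mx rmorph_unit // -unitmxE lin_rowwise_unit // => i.
  exact: layer_unit_unitmx.
move=> x y; rewrite map_lin_rowwise /twisted_br mul_vec_lin !mx_rV_lin; congr mxvec.
move: (vec_mx x) (vec_mx y) => X Y.
have layer_aut Z i : (i <= c)%N ->
    layer (rowwise (fun i : 'I_c.+1 => ratm (layer_unit i)) Z) i = layer Z i *m ratm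
        (layer_unit i).
  by move=> ic; rewrite /layer rowK inordK.
apply: layerP => i ic; rewrite layer_aut // !layer_mxbr //.
case: i ic => [|[|i]] ic /=; rewrite ?mul0mx // !layer_aut ?(ltnW ic) //=.
  rewrite -!mulmxA !tAsig !mulmxA ![mul _ (_ *m ratm (tB E))]tmulC !tmulB.
  by rewrite ![mul (_ *m S) _]tmulC !tmulA mulmxBl expr1 !map_mxM !mulmxA.
rewrite !tmul_layer_unit_r !tmulA mulmxBl [tA E ^+ i.+2]exprS.
by rewrite !map_mxM !mulmxA.
Qed.

(** A nonzero row of an eigenvector is an eigenvector, for the same eigenvalue, of the unit acting
    on that layer. *)
Lemma br_anosov : anosov twisted_br.
Proof.
exists (ratm layer_autZ); split.
- exact: layer_autZ_aut.
- move=> z; rewrite map_char_poly -map_mx_comp.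
  rewrite (eq_map_mx _ (ratr_int _)) map_lin_rowwise.
  rewrite -eigenvalue_root_char => /eigenvalueP[v].
  rewrite -[v]vec_mxK; move: (vec_mx v) => W {v}.
  rewrite mul_vec_lin -linearZ => /(can_inj (@mxvecK _ _ _)) Wz Wn0.
  have [i Wi0] : exists i, row i W != 0.
    apply/existsP; apply: contraNT Wn0; rewrite negb_exists => /forallP W0.
    apply/eqP; rewrite -[RHS](linear0 mxvec); congr mxvec.
    by apply/row_matrixP=> i; rewrite row0; apply/eqP/negbNE/W0.
  apply: (layer_unit_hyp (i := i) Wi0).
  by move/(congr1 (row i)): Wz; rewrite rowK [in RHS]linearZ.
by apply: int_unitmx_integer_like; apply: lin_rowwise_unit => i; apply:
    layer_unit_unitmx.
Qed.

End LieAlgebra.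

Lemma anosov_of_twisted n c : (0 < n)%N -> (0 < c)%N -> twisted_algebra n ->
  exists (d : nat) (br : 'rV[rat]_d -> 'rV[rat]_d -> 'rV[rat]_d),
    [/\ is_lie_algebra br, has_nil_class br c, has_constant_type br c n
      & anosov br].
Proof.
case: c => // c n0 _ E; exists (c.+1 * n)%N, (@twisted_br n c E); split.
- exact: br_is_lie.
- exact: br_nil_class.
- exact: br_constant_type.
exact: br_anosov.
Qed.

(** * Products *)

Section DirectSum.
Variables m n : nat.

Lemma row_mx_block (R : pzRingType) (u : 'rV[R]_m) (v : 'rV[R]_n)
    (A : 'M[R]_m) (B : 'M[R]_n) :
  row_mx u v *m block_mx A 0 0 B = row_mx (u *m A) (v *m B).
Proof. by rewrite mul_row_block !mulmx0 addr0 add0r. Qed.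

Lemma mul_block_diag (R : pzRingType) (A A' : 'M[R]_m) (B B' : 'M[R]_n) :
  block_mx A 0 0 B *m block_mx A' 0 0 B' = block_mx (A *m A') 0 0 (B *m B').
Proof. by rewrite mulmx_block !mulmx0 !mul0mx !addr0 add0r. Qed.

Lemma block_diag_exp (R : pzRingType) (A : 'M[R]_m) (B : 'M[R]_n) k :
  block_mx A 0 0 B ^+ k = block_mx (A ^+ k) 0 0 (B ^+ k).
Proof.
elim: k => [|k IH]; first by rewrite !expr0 -scalar_mx_block.
by rewrite !exprS IH -!mulmxE mul_block_diag.
Qed.

Lemma block_diag_unit (A : 'M[int]_m) (B : 'M[int]_n) :
  A \in unitmx -> B \in unitmx -> block_mx A 0 0 B \in unitmx.
Proof. by rewrite !unitmxE det_ublock unitrM => -> ->. Qed.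

(** One half of an eigenvector is nonzero, hence an eigenvector of its block. *)
Lemma block_diag_hyp (A : 'M[int]_m) (B : 'M[int]_n) :
  no_unit_eigenvalue A -> no_unit_eigenvalue B ->
  no_unit_eigenvalue (block_mx A 0 0 B).
Proof.
move=> hA hB z v; rewrite -[v]hsubmxK map_block_mx !map_mx0 row_mx_block scale_row_mx.
move: (lsubmx v) (rsubmx v) => a b ab0 /eq_row_mx[az bz].
have [a0|] := eqVneq a 0; last by move/hA; apply.
have [b0|] := eqVneq b 0; last by move/hB; apply.
by rewrite a0 b0 row_mx0 eqxx in ab0.
Qed.

Variables (E : twisted_algebra m) (F : twisted_algebra n).

Definition sum_mul (u v : 'rV[rat]_(m + n)) : 'rV[rat]_(m + n) :=
  row_mx (tmul E (lsubmx u) (lsubmx v)) (tmul F (rsubmx u) (rsubmx v)).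

Lemma sum_mulE a b x y :
  sum_mul (row_mx a b) (row_mx x y) = row_mx (tmul E a x) (tmul F b y).
Proof. by rewrite /sum_mul !row_mxKl !row_mxKr. Qed.

Lemma twisted_sum : twisted_algebra (m + n).
Proof.
apply: (@TwistedAlgebra _ sum_mul (block_mx (tsig E) 0 0 (tsig F))
  (row_mx (tone E) (tone F)) (block_mx (tA E) 0 0 (tA F))
  (block_mx (tB E) 0 0 (tB F))).
- by move=> u v; rewrite /sum_mul tmulC (tmulC F).
- move=> u a v w; rewrite /sum_mul !linearP /= !tmulP.
  by rewrite scale_row_mx add_row_mx.
- move=> u v w; rewrite /sum_mul !row_mxKl !row_mxKr tmulCA.
  by rewrite (tmulCA F).
- by move=> u; rewrite -[u]hsubmxK sum_mulE !tmul1.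
- move=> u; have [s sE] := tspan E (lsubmx u); have [t tE] := tspan F (rsubmx u).
  (* Pairs supported in one factor have their bracket in that factor, so both lists are padded with
     0 and concatenated. *)
  exists ([seq (row_mx p.1 0, row_mx p.2 0) | p <- s]
       ++ [seq (row_mx 0 p.1, row_mx 0 p.2) | p <- t]).
  rewrite big_cat !big_map /= -[u in LHS]hsubmxK [lsubmx u]sE [rsubmx u]tE.
  have -> a b : row_mx a b = row_mx a 0 + row_mx 0 b :> 'rV[rat]_(m + n).
    by rewrite add_row_mx addr0 add0r.
  congr (_ + _).
    elim: (s) => [|p r IH]; first by rewrite !big_nil row_mx0.
    rewrite !big_cons -IH !row_mx_block !sum_mulE !mul0mx !tmulr0 opp_row_mx.
    by rewrite !add_row_mx subrr addr0.
  elim: (t) => [|p r IH]; first by rewrite !big_nil row_mx0.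
  rewrite !big_cons -IH !row_mx_block !sum_mulE !mul0mx !tmulr0 opp_row_mx.
  by rewrite !add_row_mx subrr addr0.
- by apply: block_diag_unit; apply: tA_unit.
- by apply: block_diag_unit; apply: tB_unit.
- move=> u v; rewrite -[u]hsubmxK -[v]hsubmxK map_block_mx !map_mx0 row_mx_block.
  by rewrite !sum_mulE row_mx_block !tmulA.
- move=> u v; rewrite -[u]hsubmxK -[v]hsubmxK map_block_mx !map_mx0 row_mx_block.
  by rewrite !sum_mulE row_mx_block !tmulB.
- by rewrite !map_block_mx !map_mx0 !mul_block_diag !tAsig.
- by apply: block_diag_hyp; apply: tA_hyp.
move=> k; rewrite block_diag_exp mul_block_diag.
by apply: block_diag_hyp; apply: tAB_hyp.
Qed.

End DirectSum.

(** * Quotients of Z[x] with the endomorphism x -> x^2 - 2 *)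

Section Companion.
Variables (R : comNzRingType) (n : nat) (a : seq R).
Hypothesis sza : size a = n.+1.

(** The list [a] holds only the coefficients below the leading 1, so the polynomial is monic by
    construction. *)
Definition monic_of : {poly R} := 'X^(size a) + Poly a.

(** The companion matrix: multiplication by X on row vectors, in the basis of the powers of X modulo
    [monic_of]. *)
Definition cyclic_mx : 'M[R]_n.+1 :=
  \matrix_(i < n.+1) (if i == n :> nat then - poly_rV (Poly a)
                      else delta_mx 0 (inord i.+1)).

Lemma e0_cyclic_mx_exp i : (i <= n)%N -> delta_mx 0 0 *m cyclic_mx ^+ i = delta_mx 0
    (inord i) :> 'rV_n.+1.
Proof.
elim: i => [|i IH] ilt.
  by rewrite expr0 mulmx1; congr delta_mx; apply: val_inj; rewrite /= inordK.
rewrite exprSr mulmxA IH 1?ltnW // -rowE rowK inordK ?ltnS 1?ltnW //.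
by rewrite ltn_eqF.
Qed.

(* The class of [p] modulo [monic_of a], in the basis of the powers of X. *)
Definition residue (p : {poly R}) : 'rV[R]_n.+1 := delta_mx 0 0 *m horner_mx cyclic_mx
    p.

Lemma residue_linear : linear residue.
Proof. by move=> c p q; rewrite /residue linearP /= mulmxDr -scalemxAr. Qed.

HB.instance Definition _ :=
  GRing.isLinear.Build R {poly R} 'rV[R]_n.+1 *:%R residue residue_linear.

Lemma residue_mul p q : residue (p * q) = residue p *m horner_mx cyclic_mx q.
Proof. by rewrite /residue rmorphM /= -mulmxE mulmxA. Qed.

Lemma residueX i : (i <= n)%N -> residue 'X^i = delta_mx 0 (inord i).
Proof. by move=> ic; rewrite /residue rmorphXn /= horner_mx_X e0_cyclic_mx_exp. Qed.

Lemma residue_rVpoly u : residue (rVpoly u) = u.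
Proof.
rewrite {1}[u]row_sum_delta linear_sum linear_sum {2}[u]row_sum_delta.
apply: eq_bigr => i _; rewrite linearZ linearZ /=; congr (_ *: _).
by rewrite rVpoly_delta residueX ?inord_val // -ltnS.
Qed.

(** The first basis vector is cyclic: row [i] of the matrix is the residue of X^i p, which is the
    image of the residue of [p] under X^i. *)
Lemma residue_eq0_horner p : residue p = 0 -> horner_mx cyclic_mx p = 0.
Proof.
move=> p0; apply/row_matrixP=> i; rewrite rowE row0.
rewrite -[i]inord_val -residueX; last by rewrite -ltnS.
by rewrite -residue_mul mulrC residue_mul p0 mul0mx.
Qed.

(** Cayley-Hamilton for the companion matrix. It suffices to test the cyclic vector, and there the
    last row cancels [Poly a]. *)
Lemma horner_monic_of : horner_mx cyclic_mx monic_of = 0.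
Proof.
apply: residue_eq0_horner; rewrite /monic_of linearD /= sza exprSr residue_mul residueX
    //.
rewrite horner_mx_X -rowE rowK inordK // eqxx.
by rewrite -{2}(poly_rV_K (d := n.+1) (p := Poly a)) ?residue_rVpoly ?addNr // -sza
    size_Poly.
Qed.

End Companion.

Lemma map_cyclic_mx (R S : comNzRingType) (f : {rmorphism R -> S}) n (a : seq R) :
  map_mx f (cyclic_mx n a) = cyclic_mx n (map f a).
Proof.
apply/row_matrixP=> i; rewrite -map_row !rowK; case: eqP => _.
  rewrite map_mxN; congr (- _); apply/rowP=> j; rewrite !mxE !coef_Poly.
  have [ja|aj] := ltnP j (size a); first by rewrite (nth_map 0).
  by rewrite !nth_default ?size_map //; apply: rmorph0.
exact: map_delta_mx.
Qed.

Lemma map_monic_of (R S : comNzRingType) (f : {rmorphism R -> S}) (a : seq R) :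
  map_poly f (monic_of a) = monic_of (map f a).
Proof.
rewrite /monic_of rmorphD /= map_polyXn size_map; congr (_ + _).
by apply/polyP=> i; rewrite coef_map !coef_Poly /=;
   have [ja|aj] := ltnP i (size a); [rewrite (nth_map 0) |
   rewrite !nth_default ?size_map //; apply: rmorph0].
Qed.

Section CompanionField.
Variables (F : fieldType) (n : nat) (a : seq F).
Hypothesis sza : size a = n.+1.

(** The remainder of [p] has the same residue as [p] and degree at most [n], so it can be read off
    from that residue. *)
Lemma residue_eq0_dvdp p : residue n a p = 0 -> exists q, p = monic_of a * q.
Proof.
have szf : size (monic_of a) = n.+2.
  by rewrite /monic_of size_polyDl size_polyXn sza // ltnS -sza size_Poly.
have fn0 : monic_of a != 0 by rewrite -size_poly_eq0 szf.
rewrite [in residue _ _ _](divp_eq p (monic_of a)) mulrC linearD /= mulrC residue_mul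
    horner_monic_of //.
rewrite mulmx0 add0r => r0; exists (p %/ monic_of a).
rewrite mulrC {1}(divp_eq p (monic_of a)).
have szr : (size (p %% monic_of a)%R <= n.+1)%N by rewrite -ltnS -szf ltn_modp.
by rewrite -[p %% _](poly_rV_K szr) -(residue_rVpoly a (poly_rV _)) poly_rV_K // r0
  linear0 addr0.
Qed.
End CompanionField.

(** * Twisted algebras from polynomial identities over the integers *)

Section PolynomialTwistedAlgebra.
Variables (n : nat) (a : seq int).
Hypothesis sza : size a = n.+1.
Local Notation f := (monic_of a).
Local Notation s := ('X^2 - 2 : {poly int}).
(** Explicit cofactors turn divisibility by f and invertibility of X modulo f into identities that
    [ring] can check. *)
Variables h g k : {poly int}.
Hypothesis f_comp_s : f \Po s = f * h.
Hypothesis X_unit : 'X * g = 1 + f * k.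
(** The integer [m] clears denominators; a triple [(c, i, j)] stands for [c] times the bracket of
    X^i and X^j. *)
Hypothesis span_hyp : forall i, (i <= n)%N ->
  exists (m : nat) (l : seq (int * nat * nat)) (q : {poly int}),
  (0 < m)%N /\
  'X^i *+ m = \sum_(t <- l) t.1.1%:P * ('X^(t.1.2) * s ^+ t.2 - 'X^(t.2) * s ^+ t.1.2)
            + f * q.
Hypothesis root_hyp : forall r : algC, root (map_poly intr f) r ->
  `|r| != 1 /\ forall j, `|r ^+ j * (r ^+ 2 - 2)| != 1.

Local Notation toQ := (map_poly (intr : int -> rat)).
Local Notation aQ := (map (intr : int -> rat) a).
Local Notation fQ := (monic_of aQ).
Local Notation sQ := ('X^2 - 2 : {poly rat}).
Local Notation resQ := (residue n aQ).

Lemma szaQ : size aQ = n.+1. Proof. by rewrite size_map. Qed.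

Lemma resQ_multiple q : resQ (fQ * q) = 0.
Proof. by rewrite mulrC residue_mul horner_monic_of ?mulmx0 // szaQ. Qed.

Lemma toQ_s : toQ s = sQ.
Proof. by rewrite rmorphB /= map_polyXn rmorph_nat. Qed.

Lemma fQ_comp_s : fQ \Po sQ = fQ * toQ h.
Proof. by rewrite -map_monic_of -toQ_s -map_comp_poly f_comp_s rmorphM. Qed.

Definition qmul (u v : 'rV[rat]_n.+1) := resQ (rVpoly u * rVpoly v).

Definition qsig : 'M[rat]_n.+1 := lin1_mx (fun u => resQ (rVpoly u \Po sQ)).

Lemma resQ_eq p q : resQ p = resQ q -> exists d, p = q + fQ * d.
Proof.
move=> pq; have [|d dE] := residue_eq0_dvdp szaQ (p := p - q).
  by rewrite linearB /= pq subrr.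
by exists d; rewrite -dE addrC subrK.
Qed.

Lemma qmulE p q : qmul (resQ p) (resQ q) = resQ (p * q).
Proof.
have [d dE] : exists d, rVpoly (resQ p) = p + fQ * d by apply/resQ_eq/residue_rVpoly.
have [e eE] : exists d, rVpoly (resQ q) = q + fQ * d by apply/resQ_eq/residue_rVpoly.
rewrite /qmul dE eE; have -> : (p + fQ * d) * (q + fQ * e) =
  p * q + fQ * (d * q + p * e + fQ * d * e) by ring.
by rewrite linearD /= resQ_multiple addr0.
Qed.

Lemma qsig_fun_linear : linear (fun u : 'rV[rat]_n.+1 => resQ (rVpoly u \Po sQ)).
Proof. by move=> c u v; rewrite linearP comp_polyD comp_polyZ linearP. Qed.

(** Substituting X^2 - 2 is independent of the representative because it sends f to a multiple of
    f. *)
Lemma qsigE p : resQ p *m qsig = resQ (p \Po sQ).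
Proof.
pose F : {linear 'rV[rat]_n.+1 -> 'rV[rat]_n.+1} :=
  HB.pack (fun u : 'rV[rat]_n.+1 => resQ (rVpoly u \Po sQ))
    (GRing.isLinear.Build _ _ _ _ _ qsig_fun_linear).
rewrite [LHS](mul_rV_lin1 F) /=.
have [d ->] : exists d, rVpoly (resQ p) = p + fQ * d by apply/resQ_eq/residue_rVpoly.
by rewrite comp_polyD comp_polyM fQ_comp_s -mulrA linearD /= resQ_multiple addr0.
Qed.

Lemma resQ_horner p (q : {poly int}) :
  resQ p *m map_mx intr (horner_mx (cyclic_mx n a) q) = resQ (p * toQ q).
Proof. by rewrite map_horner_mx map_cyclic_mx residue_mul. Qed.

Lemma qmulA (q : {poly int}) (M := map_mx intr (horner_mx (cyclic_mx n a) q)) u v :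
  qmul (u *m M) v = qmul u v *m M.
Proof.
rewrite -(residue_rVpoly aQ u) -(residue_rVpoly aQ v) /M !(resQ_horner, qmulE).
by rewrite mulrAC.
Qed.

Definition spanned (u : 'rV[rat]_n.+1) :=
  exists l : seq ('rV[rat]_n.+1 * 'rV[rat]_n.+1),
    u = \sum_(p <- l) (qmul p.1 (p.2 *m qsig) - qmul p.2 (p.1 *m qsig)).

Lemma spannedD u v : spanned u -> spanned v -> spanned (u + v).
Proof. by move=> [l ->] [l' ->]; exists (l ++ l'); rewrite big_cat. Qed.

Lemma qmulZl c u v : qmul (c *: u) v = c *: qmul u v.
Proof. by rewrite /qmul linearZ -scalerAl linearZ. Qed.

Lemma qmulC : commutative qmul.
Proof. by move=> u v; rewrite /qmul mulrC. Qed.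

(** A scalar is absorbed by the first entry of each pair, which is why [spanned] can do without
    coefficients. *)
Lemma spannedZ c u : spanned u -> spanned (c *: u).
Proof.
move=> [l ->]; exists [seq (c *: p.1, p.2) | p <- l].
rewrite big_map scaler_sumr; apply: eq_bigr => p _ /=.
by rewrite -scalemxAl [qmul p.2 (c *: _)]qmulC !qmulZl [qmul _ p.2]qmulC scalerBr.
Qed.

Lemma spannedT u : spanned u.
Proof.
rewrite (row_sum_delta u); elim/big_ind: _ => [||i _].
- by exists [::]; rewrite big_nil.
- exact: spannedD.
apply: spannedZ.
have [|m [l [q [m0 lE]]]] := span_hyp (i := i); first by rewrite -ltnS.
rewrite -[i]inord_val -(residueX aQ); last by rewrite -ltnS.
have mn0 : m%:R != 0 :> rat by rewrite pnatr_eq0 -lt0n.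
rewrite -[resQ _](scalerK mn0); apply: spannedZ.
rewrite scaler_nat -linearMn /= -(map_polyXn intr) -raddfMn /= lE.
rewrite rmorphD rmorphM /= map_monic_of linearD /= resQ_multiple addr0.
exists [seq (t.1.1%:~R *: resQ 'X^(t.1.2), resQ 'X^(t.2)) | t <- l].
rewrite big_map rmorph_sum linear_sum; apply: eq_bigr => t _ /=.
rewrite -scalemxAl [qmul _ (_ *: _)]qmulC !qmulZl [qmul (_ *m _) _]qmulC -scalerBr.
rewrite !qsigE !qmulE -linearB rmorphM /= map_polyC mul_polyC linearZ /=.
congr (_ *: resQ _); rewrite rmorphB !rmorphM /= !rmorphXn /= toQ_s map_polyX.
by rewrite !comp_polyX.
Qed.

(** If |z| = 1, then q - z has no root in common with f. A Bezout relation, evaluated at the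
    companion matrix where f vanishes, makes q - z invertible there, so it kills no nonzero
    vector. *)
Lemma horner_hyp q :
  (forall r : algC, root (map_poly intr f) r -> `|(map_poly intr q).[r]| != 1) ->
  no_unit_eigenvalue (horner_mx (cyclic_mx n a) q).
Proof.
move=> hq z v vn0 vz; apply: contraNneq vn0 => z1.
have /Bezout_eq1_coprimepP[[x y] /= xy] :
    coprimep (map_poly intr f) (map_poly intr q - z%:P).
  apply/Pdiv.ClosedField.coprimepP=> r /hq.
  by rewrite !hornerE subr_eq0; apply: contraNneq => ->; rewrite z1.
rewrite [y * _]mulrC in xy; have := congr1 (horner_mx (cyclic_mx n (map (intr : int ->
    algC) a))) xy.
rewrite rmorphD !rmorphM /= map_monic_of horner_monic_of ?size_map // mulr0 add0r.
rewrite rmorph1 => H; rewrite -[v]mulmx1 -[1%:M]/1 -H -mulmxE.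
rewrite mulmxA rmorphB /= horner_mx_C mulmxBr.
by rewrite -map_cyclic_mx -map_horner_mx vz mul_mx_scalar subrr mul0mx.
Qed.

Lemma horner_unit p q d : p * q = 1 + f * d -> horner_mx (cyclic_mx n a) p \in unitmx.
Proof.
move=> pq; apply: (proj1 (mulmx1_unit (B := horner_mx (cyclic_mx n a) q) _)).
rewrite mulmxE -rmorphM pq rmorphD rmorphM /= horner_monic_of // mul0r addr0.
by rewrite rmorph1.
Qed.

Lemma polynomial_twisted_algebra : twisted_algebra n.+1.
Proof.
apply: (@TwistedAlgebra _ qmul qsig (resQ 1) (horner_mx (cyclic_mx n a) 'X)
  (horner_mx (cyclic_mx n a) s)).
- exact: qmulC.
- by move=> u c v w; rewrite /qmul linearP mulrDr -scalerAr linearP.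
- move=> u v w; rewrite -(residue_rVpoly aQ u) -(residue_rVpoly aQ v) -(residue_rVpoly
    aQ w).
  by rewrite !qmulE mulrCA.
- by move=> u; rewrite -(residue_rVpoly aQ u) qmulE mul1r.
- exact: spannedT.
- exact: horner_unit X_unit.
(* Substituting X^2 - 2 in [X_unit] yields the inverse of X^2 - 2 modulo f. *)
- apply: (@horner_unit _ (g \Po s) (h * (k \Po s))).
  have := congr1 (comp_poly s) X_unit.
  by rewrite rmorphD !rmorphM rmorph1 /= comp_polyX f_comp_s mulrA.
- by move=> u v; apply: qmulA.
- by move=> u v; apply: qmulA.
- apply/row_matrixP=> i; rewrite !rowE !mulmxA -(residue_rVpoly aQ (delta_mx 0 i)).
  by rewrite resQ_horner !qsigE resQ_horner comp_polyM map_polyX comp_polyX toQ_s.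
- by apply: horner_hyp => r /root_hyp[r1 _]; rewrite map_polyX hornerX.
move=> j; rewrite mulmxE -rmorphXn -rmorphM.
apply: horner_hyp => r /root_hyp[_ r2]; rewrite rmorphM rmorphB /= !map_polyXn.
by rewrite rmorph_nat !hornerE.
Qed.

End PolynomialTwistedAlgebra.

(** * Real cyclotomic examples *)

(** The roots of T^2 - r T + 1 are inverse to each other with sum [r]; [z] is one of them, given by
    the quadratic formula. *)
Lemma add_inv_root (r : algC) : exists z : algC, z != 0 /\ r = z + z^-1.
Proof.
pose z := (r + sqrtC (r ^+ 2 - 4)) / 2.
have zE : z * (r - z) = 1.
  have -> : z * (r - z) = (r ^+ 2 - sqrtC (r ^+ 2 - 4) ^+ 2) / 4 by rewrite /z; field.
  by rewrite sqrtCK; field.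
have z0 : z != 0 by apply: contra_eq_neq zE => ->; rewrite mul0r eq_sym oner_eq0.
by exists z; split=> //; rewrite -[z^-1]mulr1 -zE mulKf // addrC subrK.
Qed.

(** The divisibility closes up the orbit of [r] under x -> x^2 - 2. The two inequalities are what
    remains to be checked in each example. *)
Lemma twocos_units (N n : nat) (z r : algC) :
  r = z + z^-1 -> odd N -> z ^+ N = 1 -> (0 < n)%N ->
  (N %| 2 ^ n + 1)%N || (N %| 2 ^ n - 1)%N ->
  r ^+ 2 != 1 -> (r * (r ^+ 2 - 2)) ^+ 2 != 1 ->
  `|r| != 1 /\ forall j, `|r ^+ j * (r ^+ 2 - 2)| != 1.
Proof.
move=> rE Nodd zN n0 N2 r1 r2; have N0 : (0 < N)%N by case: (N) Nodd.
set D := fun x : algC => x ^+ 2 - 2.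
have z0 : z != 0 by apply: contra_eq_neq zN => ->; rewrite expr0n eqn0Ngt N0 eq_sym
    oner_eq0.
have zn : `|z| = 1.
  by apply/eqP; rewrite -(pexpr_eq1 N0) ?normr_ge0 // -normrX zN normr1.
have rreal : r \is Num.real.
  by rewrite CrealE rE invC_norm zn expr1n invr1 mul1r rmorphD /= conjCK addrC.
have Dreal x : x \is Num.real -> D x \is Num.real.
  by move=> xr; rewrite /D rpredB ?rpredX ?realn.
(* As N is odd, some automorphism of [algC] squares the N-th roots of unity; it acts on [r] as
   [D]. *)
have [u uE] := Qn_aut_exists (k := 2) (n := N) (etrans (coprime2n _) Nodd).
have ur : u r = D r by rewrite rE rmorphD fmorphV /= uE // /D; field.
have uD x : u (D x) = D (u x) by rewrite /D rmorphB rmorphXn rmorph_nat.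
have ui i : u (iter i D r) = iter i.+1 D r.
  by elim: i => [|i IH] //=; rewrite uD IH.
have ireal i : iter i D r \is Num.real by elim: i => //= i; apply: Dreal.
have iterE i : iter i D r = z ^+ (2 ^ i) + z ^- (2 ^ i).
  elim: i => [|i IH] /=; first by rewrite expr1.
  have y0 : z ^+ (2 ^ i) != 0 by rewrite expf_neq0.
  by rewrite IH expnSr exprM /D; field.
(* Modulo N, 2^n is 1 or -1, and [z] and its inverse give the same [r]. *)
have iterr : iter n D r = r.
  rewrite iterE rE; have /orP[/(expr_dvd zN)|/(expr_dvd zN)] := N2.
    by rewrite addn1 exprSr => /(canRL (mulfK z0)) ->; rewrite mul1r invrK addrC.
  by move=> z1; rewrite -[(2 ^ n)%N]prednK ?expn_gt0 // -subn1 exprSr z1 mul1r.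
pose p i := iter i D r ^+ 2.
split=> [|j]; first by rewrite -(pexpr_eq1 (n := 2)) ?normr_ge0 // real_normK.
rewrite -(pexpr_eq1 (n := 2)) ?normr_ge0 // real_normK; last first.
  by rewrite rpredM ?rpredX // Dreal.
apply/negP=> /eqP.
have -> : (r ^+ j * (r ^+ 2 - 2)) ^+ 2 = p 0%N ^+ j * p 1%N.
  by rewrite exprMn -exprM mulnC exprM.
move=> p01.
have pS i : p i ^+ j * p i.+1 = 1.
  elim: i => // i IH; have := congr1 u IH.
  by rewrite rmorphM rmorphXn rmorph1 /p !rmorphXn !ui.
(* Two consecutive relations: p_(i+2) = p_(i+1)^(-j) = p_i^(j^2). *)
have pSS i : p i.+2 = p i ^+ (j ^ 2).
  rewrite -[LHS]mul1r -(expr1n _ j) -(pS i) exprMn -exprM -mulrA pS mulr1.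
  by rewrite expnS expn1.
have p2 i : p (i.*2) = p 0%N ^+ ((j ^ 2) ^ i).
  elim: i => [|i IH]; first by rewrite expn0 expr1.
  by rewrite doubleS pSS IH -exprM -expnSr.
have : p 0%N ^+ ((j ^ 2) ^ n) = p 0%N.
  by rewrite -p2 /p -addnn iterD iterr iterr.
have p0ge : 0 <= p 0%N by rewrite real_exprn_even_ge0.
(* For [j = 0] the exponent is 0 as [n > 0], giving p_0 = 1. For [j = 1] it is 1 and says nothing,
   so the last hypothesis is invoked. Otherwise it exceeds 1, and p_0 is a positive real with a
   nontrivial power equal to 1. *)
case: j p01 pS pSS p2 => [|[|j]] p01 _ _ _.
- by rewrite exp0n // exp0n // => /eqP; rewrite expr0 eq_sym (negbTE r1).
- by move: r2; rewrite exprMn -/(D r) -[_ ^+ 2 * _]/(p 0%N * p 1%N) -[p 0%N]expr1 p01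
    eqxx.
have p0n0 : p 0%N != 0.
  by apply: contra_eq_neq p01 => ->; rewrite expr0n mul0r eq_sym oner_eq0.
have : (1 < (j.+2 ^ 2) ^ n)%N by rewrite -expnM -{1}(expn0 j.+2) ltn_exp2l // muln_gt0.
case: (_ ^ n)%N => [|[|m]] // _; rewrite exprSr -[RHS]mul1r => /(mulIf p0n0)/eqP.
by rewrite pexpr_eq1 // (negbTE r1).
Qed.

(** The cyclotomic polynomial of order 7 is z^3 f(z + 1/z), and 7 = 2^3 - 1. *)
Lemma root_cyclotomic7 (r : algC) : - 1 - 2 * r + r ^+ 2 + r ^+ 3 = 0 ->
  `|r| != 1 /\ forall j, `|r ^+ j * (r ^+ 2 - 2)| != 1.
Proof.
move=> r0; have [z [z0 rE]] := add_inv_root r.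
have zN : z ^+ 7 = 1.
  apply/eqP; rewrite -subr_eq0; apply/eqP.
  have -> : z ^+ 7 - 1 = (- 1 + z) * z ^+ 3 * (- 1 - 2 * r + r ^+ 2 + r ^+ 3) by
      rewrite rE; field.
  by rewrite r0 mulr0.
apply: (@twocos_units 7 3 z r) => //.
(* Both exclusions exhibit a nonzero constant as an integral combination of f and the excluded
   polynomial. *)
- apply/eqP=> r1; have : 1%:R = 0 :> algC.
    have -> : 1%:R = (- 1 - 2 * r + r ^+ 2 + r ^+ 3) * (- r) + (r ^+ 2 - 1) * (- 1 + r
        + r ^+ 2) by ring.
    by rewrite r0 r1 subrr !mul0r addr0.
  by apply/eqP; rewrite pnatr_eq0.
apply/eqP=> r1; have : 1%:R = 0 :> algC.
  have -> : 1%:R = (- 1 - 2 * r + r ^+ 2 + r ^+ 3) * (2 - 4 * r - 3 * r ^+ 2 + 4 * r ^+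
      3 + r ^+ 4 - r ^+ 5)
    + ((r * (r ^+ 2 - 2)) ^+ 2 - 1) * (- 3 + r ^+ 2) by ring.
  by rewrite r0 r1 subrr !mul0r addr0.
by apply/eqP; rewrite pnatr_eq0.
Qed.

(* The combinations below were found by solving the linear system over Q; the
   last component is the quotient by f. *)
Lemma twisted_algebra3 : twisted_algebra 3.
Proof.
pose a : seq int := [:: -1; -2; 1].
have fE : monic_of a = - 1 - 2 * 'X + 'X^2 + 'X^3 by rewrite /monic_of /=
    !cons_poly_def; ring.
(* The cofactor in f(X^2 - 2) is (-1)^(deg f) f(-X), here and in degrees 4 and 5: the preimages of a
   root under x -> x^2 - 2 are a root and its opposite. The inverse of X comes from f(0) = -1. *)
apply: (@polynomial_twisted_algebra 2 a erefl (1 - 2 * 'X - 'X^2 + 'X^3) (- 2 + 'X +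
    'X^2) (1)).
- rewrite fE !comp_polyD ?rmorphN /= !comp_polyM !comp_polyX ?comp_Xn_poly.
  by rewrite ?rmorph_nat ?rmorph1; ring.
- by rewrite fE; ring.
- case=> [|[|[|i]]] // _.
  - exists 7%N, [:: (-5%R, 0, 1); (-1%R, 0, 2); (-3%R, 1, 2)]%N,
      (- 1 - 5 * 'X + 3 * 'X^2); split => //.
    by rewrite fE !big_cons big_nil /=; ring.
  - exists 7%N, [:: (-3%R, 0, 1); (-2%R, 0, 2); (1%R, 1, 2)]%N,
      (- 2 + 4 * 'X - 'X^2); split => //.
    by rewrite fE !big_cons big_nil /=; ring.
  - exists 7%N, [:: (-6%R, 0, 1); (-4%R, 0, 2); (-5%R, 1, 2)]%N,
      (- 4 - 6 * 'X + 5 * 'X^2); split => //.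
    by rewrite fE !big_cons big_nil /=; ring.
move=> r; rewrite fE rootE => /eqP r0; apply: root_cyclotomic7.
by rewrite -[RHS]r0 !(rmorphE, rmorphM) /= ?map_polyX ?map_polyXn !hornerE /=; ring.
Qed.

(** The cofactor of the cyclotomic polynomial in z^15 - 1 is (z^5 - 1)(z^2 + z + 1), and 15 = 2^4 -
    1. *)
Lemma root_cyclotomic15 (r : algC) : 1 + 4 * r - 4 * r ^+ 2 - r ^+ 3 + r ^+ 4 = 0 ->
  `|r| != 1 /\ forall j, `|r ^+ j * (r ^+ 2 - 2)| != 1.
Proof.
move=> r0; have [z [z0 rE]] := add_inv_root r.
have zN : z ^+ 15 = 1.
  apply/eqP; rewrite -subr_eq0; apply/eqP.
  have -> : z ^+ 15 - 1 = (- 1 - z - z ^+ 2 + z ^+ 5 + z ^+ 6 + z ^+ 7) * z ^+ 4 * (1 +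
      4 * r - 4 * r ^+ 2 - r ^+ 3 + r ^+ 4) by rewrite rE; field.
  by rewrite r0 mulr0.
apply: (@twocos_units 15 4 z r) => //.
(* Since f(-1) = -5, a constant integral combination of f and r^2 - 1 must be a multiple of 5. *)
- apply/eqP=> r1; have : 5%:R = 0 :> algC.
    have -> : 5%:R = (1 + 4 * r - 4 * r ^+ 2 - r ^+ 3 + r ^+ 4) * (2 + 3 * r) + (r ^+ 2
        - 1) * (- 3 + 11 * r + r ^+ 2 - 3 * r ^+ 3) by ring.
    by rewrite r0 r1 subrr !mul0r addr0.
  by apply/eqP; rewrite pnatr_eq0.
apply/eqP=> r1; have : 15%:R = 0 :> algC.
  have -> : 15%:R = (1 + 4 * r - 4 * r ^+ 2 - r ^+ 3 + r ^+ 4) * (- 6 + 11 * r + 23 * r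
      ^+ 2 + 2 * r ^+ 3 - 11 * r ^+ 4 - 4 * r ^+ 5)
    + ((r * (r ^+ 2 - 2)) ^+ 2 - 1) * (- 21 - 13 * r + 7 * r ^+ 2 + 4 * r ^+ 3) by ring.
  by rewrite r0 r1 subrr !mul0r addr0.
by apply/eqP; rewrite pnatr_eq0.
Qed.

Lemma twisted_algebra4 : twisted_algebra 4.
Proof.
pose a : seq int := [:: 1; 4; -4; -1].
have fE : monic_of a = 1 + 4 * 'X - 4 * 'X^2 - 'X^3 + 'X^4 by rewrite /monic_of /=
    !cons_poly_def; ring.
apply: (@polynomial_twisted_algebra 3 a erefl (1 - 4 * 'X - 4 * 'X^2 + 'X^3 + 'X^4) (-
    4 + 4 * 'X + 'X^2 - 'X^3) (-1)).
- rewrite fE !comp_polyD ?rmorphN /= !comp_polyM !comp_polyX ?comp_Xn_poly.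
  by rewrite ?rmorph_nat ?rmorph1; ring.
- by rewrite fE; ring.
- case=> [|[|[|[|i]]]] // _.
  - exists 15%N, [:: (-7%R, 0, 1); (-2%R, 0, 2); (-4%R, 1, 2); (-1%R, 0, 3)]%N,
      (1 + 5 * 'X + 'X^2); split => //.
    by rewrite fE !big_cons big_nil /=; ring.
  - exists 15%N, [:: (2%R, 0, 1); (-8%R, 0, 2); (-1%R, 1, 2); (-4%R, 0, 3)]%N,
      (4 + 5 * 'X + 4 * 'X^2); split => //.
    by rewrite fE !big_cons big_nil /=; ring.
  - exists 15%N, [:: (3%R, 0, 1); (-12%R, 0, 2); (-9%R, 1, 2); (-6%R, 0, 3)]%N,
      (6 + 15 * 'X + 6 * 'X^2); split => //.
    by rewrite fE !big_cons big_nil /=; ring.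
  - exists 15%N, [:: (32%R, 0, 1); (-23%R, 0, 2); (-1%R, 1, 2); (-19%R, 0, 3)]%N,
      (4 + 20 * 'X + 19 * 'X^2); split => //.
    by rewrite fE !big_cons big_nil /=; ring.
move=> r; rewrite fE rootE => /eqP r0; apply: root_cyclotomic15.
by rewrite -[RHS]r0 !(rmorphE, rmorphM) /= ?map_polyX ?map_polyXn !hornerE /=; ring.
Qed.

(** Here the sign is the other one: 11 divides 2^5 + 1 = 33. *)
Lemma root_cyclotomic11 (r : algC) : 1 + 3 * r - 3 * r ^+ 2 - 4 * r ^+ 3 + r ^+ 4 + r
    ^+ 5 = 0 ->
  `|r| != 1 /\ forall j, `|r ^+ j * (r ^+ 2 - 2)| != 1.
Proof.
move=> r0; have [z [z0 rE]] := add_inv_root r.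
have zN : z ^+ 11 = 1.
  apply/eqP; rewrite -subr_eq0; apply/eqP.
  have -> : z ^+ 11 - 1 = (- 1 + z) * z ^+ 5 * (1 + 3 * r - 3 * r ^+ 2 - 4 * r ^+ 3 + r
      ^+ 4 + r ^+ 5) by rewrite rE; field.
  by rewrite r0 mulr0.
apply: (@twocos_units 11 5 z r) => //.
- apply/eqP=> r1; have : 1%:R = 0 :> algC.
    have -> : 1%:R = (1 + 3 * r - 3 * r ^+ 2 - 4 * r ^+ 3 + r ^+ 4 + r ^+ 5) * (- 1) +
        (r ^+ 2 - 1) * (- 2 - 3 * r + r ^+ 2 + r ^+ 3) by ring.
    by rewrite r0 r1 subrr !mul0r addr0.
  by apply/eqP; rewrite pnatr_eq0.
apply/eqP=> r1; have : 1%:R = 0 :> algC.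
  have -> : 1%:R = (1 + 3 * r - 3 * r ^+ 2 - 4 * r ^+ 3 + r ^+ 4 + r ^+ 5) * (1 + 3 * r
      - 3 * r ^+ 2 - 4 * r ^+ 3 + r ^+ 4 + r ^+ 5)
    + ((r * (r ^+ 2 - 2)) ^+ 2 - 1) * (6 * r + 3 * r ^+ 2 - 2 * r ^+ 3 - r ^+ 4) by
        ring.
  by rewrite r0 r1 subrr !mul0r addr0.
by apply/eqP; rewrite pnatr_eq0.
Qed.

Lemma twisted_algebra5 : twisted_algebra 5.
Proof.
pose a : seq int := [:: 1; 3; -3; -4; 1].
have fE : monic_of a = 1 + 3 * 'X - 3 * 'X^2 - 4 * 'X^3 + 'X^4 + 'X^5 by rewrite
    /monic_of /= !cons_poly_def; ring.
apply: (@polynomial_twisted_algebra 4 a erefl (- 1 + 3 * 'X + 3 * 'X^2 - 4 * 'X^3 -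
    'X^4 + 'X^5) (- 3 + 3 * 'X + 4 * 'X^2 - 'X^3 - 'X^4) (-1)).
- rewrite fE !comp_polyD ?rmorphN /= !comp_polyM !comp_polyX ?comp_Xn_poly.
  by rewrite ?rmorph_nat ?rmorph1; ring.
- by rewrite fE; ring.
- case=> [|[|[|[|[|i]]]]] // _.
  - exists 11%N, [:: (19%R, 0, 1); (-6%R, 0, 2); (19%R, 1, 2); (-12%R, 0, 3); (8%R, 2,
      3)]%N,
      (- 23 + 12 * 'X + 16 * 'X^2 - 8 * 'X^3); split => //.
    by rewrite fE !big_cons big_nil /=; ring.
  - exists 11%N, [:: (-28%R, 0, 1); (-1%R, 0, 2); (-17%R, 1, 2); (9%R, 0, 3); (-6%R, 2,
      3)]%N,
      (20 - 9 * 'X - 12 * 'X^2 + 6 * 'X^3); split => //.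
    by rewrite fE !big_cons big_nil /=; ring.
  - exists 11%N, [:: (21%R, 0, 1); (-13%R, 0, 2); (21%R, 1, 2); (-15%R, 0, 3); (10%R,
      2, 3)]%N,
      (- 26 + 15 * 'X + 20 * 'X^2 - 10 * 'X^3); split => //.
    by rewrite fE !big_cons big_nil /=; ring.
  - exists 11%N, [:: (-46%R, 0, 1); (-4%R, 0, 2); (-35%R, 1, 2); (14%R, 0, 3); (-13%R,
      2, 3)]%N,
      (36 - 14 * 'X - 26 * 'X^2 + 13 * 'X^3); split => //.
    by rewrite fE !big_cons big_nil /=; ring.
  - exists 11%N, [:: (29%R, 0, 1); (-30%R, 0, 2); (29%R, 1, 2); (-27%R, 0, 3); (18%R,
      2, 3)]%N,
      (- 38 + 27 * 'X + 36 * 'X^2 - 18 * 'X^3); split => //.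
    by rewrite fE !big_cons big_nil /=; ring.
move=> r; rewrite fE rootE => /eqP r0; apply: root_cyclotomic11.
by rewrite -[RHS]r0 !(rmorphE, rmorphM) /= ?map_polyX ?map_polyXn !hornerE /=; ring.
Qed.

(** * Assembly for all n > 2 *)

Lemma twisted_algebra_exists n : (2 < n)%N -> inhabited (twisted_algebra n).
Proof.
elim/ltn_ind: n => n IH n2.
(* Factors of dimension 3 are split off until 3, 4 or 5 is left. *)
have [n6|n6] := leqP 6 n.
  have [] := IH (n - 3)%N; [by rewrite ltn_subrL (ltnW (ltnW n2))| by rewrite
      ltn_subRL|].
  move=> E; rewrite -(subnKC n2); constructor; exact: twisted_sum twisted_algebra3 E.
case: n n2 n6 {IH} => [|[|[|[|[|[|n]]]]]] // _ _; constructor.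
- exact: twisted_algebra3.
- exact: twisted_algebra4.
exact: twisted_algebra5.
Qed.

Theorem theorem3p7 (c n : nat) :
  (0 < c)%N -> (2 < n)%N ->
  exists (d : nat) (br : 'rV[rat]_d -> 'rV[rat]_d -> 'rV[rat]_d),
    [/\ is_lie_algebra br, has_nil_class br c, has_constant_type br c n
      & anosov br].
Proof.
move=> c0 n2; have [E] := twisted_algebra_exists n2.
exact: anosov_of_twisted (ltnW (ltnW n2)) c0 E.
Qed.
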